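(* Let $X$ and $Y$ be ordered linear spaces with $Y$ Dedekind complete, and let $\mathcal L$ be a linear subspace of the space of all linear operators from $X$ to $Y$. Suppose that for every $T \in \mathcal L$ the map $x \mapsto \mathcal R^+(T;x)$ is well-defined on $X_+$ and linear (that is, additive and positively homogeneous on $X_+$). Then $X$ satisfies the $\mathcal L$-Riesz Decomposition Property.
   Context: All linear spaces are over $\mathbb R$. An ordered linear space $X$ is a linear space with a partial order such that $x \geqslant y$ and $\lambda \geqslant 0$ imply $x+z \geqslant y+z$ and $\lambda x \geqslant \lambda y$; $X_+ = \{x : x \geqslant 0\}$; $[x,y] = \{z : x \leqslant z \leqslant y\}$. Sums of sets are Minkowski sums. $Y$ is Dedekind complete if every nonempty subset having an upper bound has a supremum. For a linear operator $T : X \to Y$ and $x \in X_+$, the positive Riesz-Kantorovich transform is $$\mathcal R^+(T;x) = \sup\{T(x_0)\cdot 0 + T(x_1) : x_0,x_1 \in X_+,\ x_0+x_1 \leqslant x\} = \sup\{T(u) : u \in [0,x]\},$$ defined whenever this supremum exists in $Y$. A linear map $f : X \to Y$ strictly separates a point $z \in X$ from a convex set $A \subset X$ if either $f(z) \leqslant f(a)$ for all $a \in A$ and $f(z) < \inf f(A)$, or $f(z) \geqslant f(a)$ for all $a \in A$ and $f(z) > \sup f(A)$. $X$ satisfies the $\mathcal L$-Riesz Decomposition Property if for all $x, y \in X_+$ no point $z \in [0,x+y] \setminus ([0,x]+[0,y])$ can be strictly separated from $[0,x]+[0,y]$ by a map from $\mathcal L$. *)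

(* Defs.v *)
From HB Require Import structures.
From mathcomp Require Import all_boot all_order all_algebra.
From mathcomp Require Import all_classical all_reals.

Set Implicit Arguments.
Unset Strict Implicit.
Unset Printing Implicit Defensive.

Import Order.TTheory GRing.Theory Num.Theory.
Local Open Scope classical_set_scope.
Local Open Scope ring_scope.

(* [Num.POrderedZmodule] only joins an order and a group law, without any
   compatibility between the two: the mixin supplies it. *)
HB.mixin Record Lmodule_isOrdered (R : numDomainType) V
    of Num.POrderedZmodule V & GRing.Lmodule R V := {
  lev_wD2r : forall x y z : V, y <= x -> y + z <= x + z;
  lev_wpZ2l : forall (a : R) (x y : V), 0 <= a -> y <= x -> a *: y <= a *: x
}.

#[short(type="orderedLmodType")]
HB.structure Definition OrderedLmodule (R : numDomainType) :=
  { V of Num.POrderedZmodule V & GRing.Lmodule R V & Lmodule_isOrdered R V }.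

Definition oitv (R : realType) (X : orderedLmodType R) (x y : X) : set X :=
  [set z | x <= z <= y].

Definition set_add (R : realType) (X : lmodType R) (A B : set X) : set X :=
  [set a + b | a in A & b in B].

Definition dedekind_complete (R : realType) (Y : orderedLmodType R) : Prop :=
  forall A : set Y, A !=set0 -> has_ubound A -> supremums A !=set0.

Section RieszKantorovich.
Variables (R : realType) (X Y : orderedLmodType R).
Implicit Types (T f : X -> Y) (A : set X).

(* The coefficients 0 and 1 are those of the transform attached to the
   function (t0, t1) |-> t0 * 0 + t1 * 1. *)
Definition RKplus_set T (x : X) : set Y :=
  [set y | exists x0 x1 : X,
    [/\ 0 <= x0, 0 <= x1, x0 + x1 <= x & y = 0 *: T x0 + T x1]].

Definition RKplus_defined T (x : X) : Prop := supremums (RKplus_set T x) !=set0.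

(* Meaningful only under [RKplus_defined T x]: [supremum] returns a junk value
   when there is no supremum. *)
Definition RKplus T (x : X) : Y := supremum 0 (RKplus_set T x).

Lemma RKplus_setE T (x : X) : RKplus_set T x = T @` oitv 0 x.
Proof.
apply/seteqP; split => y /=.
  move=> [x0 [x1 [x0_ge0 x1_ge0 x01 ->]]]; exists x1.
    rewrite /oitv /= x1_ge0 (le_trans _ x01)//.
    by have := lev_wD2r x0 0 x1 x0_ge0; rewrite add0r.
  by rewrite scale0r add0r.
move=> [u /andP[u_ge0 ux] <-]; exists 0, u.
by rewrite add0r scale0r add0r.
Qed.

Definition RKplus_linear T : Prop :=
  [/\ forall x : X, 0 <= x -> RKplus_defined T x,
      forall x y : X, 0 <= x -> 0 <= y ->
        RKplus T (x + y) = RKplus T x + RKplus T y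
    & forall (a : R) (x : X), 0 <= a -> 0 <= x ->
        RKplus T (a *: x) = a *: RKplus T x].

(* [f z < inf (f @` A)] is read as: the infimum exists and is above [f z]
   strictly; dually for the supremum. *)
Definition strictly_separates f (z : X) A : Prop :=
  ((forall a, A a -> f z <= f a) /\
     exists2 m, infimums (f @` A) m & f z < m) \/
  ((forall a, A a -> f a <= f z) /\
     exists2 m, supremums (f @` A) m & m < f z).

Definition Riesz_decomposition_property (L : {pred X -> Y}) : Prop :=
  forall x y z : X, 0 <= x -> 0 <= y ->
    (oitv 0 (x + y) `\` set_add (oitv 0 x) (oitv 0 y)) z ->
    ~ exists2 f, f \in L & strictly_separates f z (set_add (oitv 0 x) (oitv 0 y)).

End RieszKantorovich.

(* Main.v *)
Require Import Defs.
From mathcomp Require Import all_boot all_order all_algebra.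
From mathcomp Require Import all_classical all_reals.

(** Let [T] separate [z] in [[0, x + y]] from [[0, x] + [0, y]] from above.  By
    additivity of [T], the supremum of [T] over the Minkowski sum is at least
    [RKplus T x + RKplus T y], and by additivity of [RKplus T] this equals
    [RKplus T (x + y)], which is the supremum of [T] over the larger interval
    [[0, x + y]] and hence at least [T z].  So [T z] cannot lie strictly above
    the supremum over the sum ([RKplus_additive_ubound]).  A separation from
    below by [T] is a separation from above by [- T], and [- T] is in [L]
    because [L] is a linear subspace. *)

Import Order.TTheory GRing.Theory Num.Theory.
Local Open Scope classical_set_scope.
Local Open Scope ring_scope.

Lemma levBrDr (R : realType) (V : orderedLmodType R) (u v w : V) :
  (u <= w - v) = (u + v <= w).
Proof.
by apply/idP/idP => [/(lev_wD2r _ _ v)|/(lev_wD2r _ _ (- v))];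
  rewrite ?subrK ?addrK.
Qed.

Lemma levN2 (R : realType) (V : orderedLmodType R) (u v : V) :
  (- u <= - v) = (v <= u).
Proof.
by rewrite -[- v]add0r levBrDr addrC -[u in RHS]add0r -[u in RHS]opprK
  levBrDr.
Qed.

Lemma RKplus_supremum {R : realType} {X Y : orderedLmodType R} {T : X -> Y}
    {x : X} :
  0 <= x -> RKplus_defined T x -> supremums (T @` oitv 0 x) (RKplus T x).
Proof.
move=> x_ge0; rewrite /RKplus_defined /RKplus RKplus_setE => -[s sup_s].
rewrite /supremum; case: ifPn => [/eqP T0|_]; last first.
  exact: (xgetPex _ (ex_intro _ s sup_s)).
(* The default value of the supremum is never reached: the set contains [T 0]. *)
have: (T @` oitv 0 x) (T 0) by exists 0; rewrite // /oitv /= lexx.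
by rewrite T0.
Qed.

(** Taking suprema in [T a <= m - T b], first over [a] and then over [b], gives
    [RKplus T x + RKplus T y <= m]. *)
Lemma RKplus_additive_ubound {R : realType} {X Y : orderedLmodType R}
    {T : X -> Y} {x y z : X} {m : Y} :
  linear T -> RKplus_linear T -> 0 <= x -> 0 <= y -> oitv 0 (x + y) z ->
  ubound (T @` set_add (oitv 0 x) (oitv 0 y)) m -> T z <= m.
Proof.
move=> T_lin [RK_def RK_add _] x_ge0 y_ge0 z_xy m_ub.
have xy_ge0 : 0 <= x + y by case/andP: z_xy => /le_trans; apply.
have [_ RKx_least] := RKplus_supremum x_ge0 (RK_def _ x_ge0).
have [_ RKy_least] := RKplus_supremum y_ge0 (RK_def _ y_ge0).
have [RKxy_ub _] := RKplus_supremum xy_ge0 (RK_def _ xy_ge0).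
apply: (@le_trans _ _ (RKplus T (x + y))); first by apply: RKxy_ub; exists z.
rewrite RK_add // addrC -levBrDr.
apply: RKy_least => _ [b b_y <-].
rewrite levBrDr addrC -levBrDr.
apply: RKx_least => _ [a a_x <-].
rewrite levBrDr -[T a]scale1r -T_lin scale1r.
by apply: m_ub; exists (a + b) => //; exists a => //; exists b.
Qed.

Theorem proposition14 (R : realType) (X Y : orderedLmodType R)
  (Ycomplete : dedekind_complete Y)
  (L : {pred X -> Y})
  (L_linear : forall T : X -> Y, T \in L -> linear T)
  (L_subspace : submod_closed L)
  (RK_linear : forall T : X -> Y, T \in L -> RKplus_linear T) :
  Riesz_decomposition_property L.
Proof.
move=> x y z x_ge0 y_ge0 [z_xy _] [f fL [[_ [m [m_lb _] fz_lt]]|]]; last first.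
  move=> [_ [m [m_ub _] m_lt]].
  have fz_le : f z <= m.
    exact: RKplus_additive_ubound (L_linear _ fL) (RK_linear _ fL)
      x_ge0 y_ge0 z_xy m_ub.
  by have := lt_le_trans m_lt fz_le; rewrite ltxx.
have NfL : - f \in L.
  by have [L0 LD] := L_subspace; rewrite -[- f]addr0 -scaleN1r LD.
have Nm_ub : ubound ((- f) @` set_add (oitv 0 x) (oitv 0 y)) (- m).
  by move=> _ [c c_xy <-]; rewrite levN2; apply: m_lb; exists c.
have := RKplus_additive_ubound (L_linear _ NfL) (RK_linear _ NfL)
  x_ge0 y_ge0 z_xy Nm_ub.
by rewrite levN2 => /(lt_le_trans fz_lt); rewrite ltxx.
Qed.
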